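(* Let $n>5$ and let $\mathcal{A}$ be an $n$-dimensional complex naturally graded associative algebra with characteristic sequence $C(\mathcal{A})=(n-2,2)$. Then $\mathcal{A}$ is isomorphic to one of the following pairwise non-isomorphic algebras with basis $\{e_1,\dots,e_n\}$: \[ \begin{array}{ll} \mu_{2,2}^n(\alpha): & e_ie_j=e_{i+j},\quad e_1e_{n-1}=e_n,\quad e_{n-1}e_1=\alpha e_n,\qquad \alpha\in\mathbb{C};\\ \mu_{2,3}^n: & e_ie_j=e_{i+j},\quad e_1e_{n-1}=e_n,\quad e_{n-1}e_1=e_n,\quad e_{n-1}e_{n-1}=e_n;\\ \mu_{2,4}^n: & e_ie_j=e_{i+j},\quad e_1e_{n-1}=e_n,\quad e_{n-1}e_{n-1}=e_n, \end{array} \] where in each case the relation $e_ie_j=e_{i+j}$ holds for all $i,j\ge1$ with $2\le i+j\le n-2$, and all products of basis elements that are not listed vanish. (In particular, different values of $\alpha$ in the family $\mu_{2,2}^n(\alpha)$ give non-isomorphic algebras.)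
   Context: Associative algebras are not assumed to be unital. For an algebra $\mathcal{A}$ put $\mathcal{A}^1=\mathcal{A}$ and $\mathcal{A}^{i+1}=\sum_{k=1}^{i}\mathcal{A}^k\mathcal{A}^{i+1-k}$ for $i\ge 1$ (linear spans of products); $\mathcal{A}$ is nilpotent if $\mathcal{A}^i=0$ for some $i$. All algebras considered here are nilpotent. For a nilpotent associative algebra $\mathcal{A}$ put $\mathcal{A}_i=\mathcal{A}^i/\mathcal{A}^{i+1}$ and $\operatorname{gr}\mathcal{A}=\bigoplus_{i\ge 1}\mathcal{A}_i$, a graded algebra with the induced product $\mathcal{A}_i\mathcal{A}_j\subseteq\mathcal{A}_{i+j}$. $\mathcal{A}$ is called naturally graded if $\operatorname{gr}\mathcal{A}\cong\mathcal{A}$ as algebras. For $x\in\mathcal{A}\setminus\mathcal{A}^2$ let $L_x:\mathcal{A}\to\mathcal{A}$, $z\mapsto xz$, and let $C(x)=(n_1,n_2,\dots,n_k)$ be the decreasing sequence of sizes of the Jordan blocks of the nilpotent operator $L_x$. Such sequences are ordered lexicographically. The characteristic sequence of $\mathcal{A}$ is $C(\mathcal{A})=\max_{x\in\mathcal{A}\setminus\mathcal{A}^2}C(x)$. *)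

(* Defs.v *)
From HB Require Import structures.
From mathcomp Require Import all_boot all_order all_algebra.
From mathcomp Require Import ring_quotient zify.
From mathcomp Require Import boolp.

Set Implicit Arguments.
Unset Strict Implicit.
Unset Printing Implicit Defensive.

Import Order.TTheory GRing.Theory Quotient.
Local Open Scope ring_scope.
Local Open Scope quotient_scope.

(* A K-algebra, not assumed unital, is encoded as an lmodType over K together
   with a multiplication on it. *)
Definition alg_iso (K : pzRingType) (U V : lmodType K)
    (mulU : U -> U -> U) (mulV : V -> V -> V) : Prop :=
  exists2 f : {linear U -> V},
    bijective f & {morph f : x y / mulU x y >-> mulV x y}.

Section QuotientSpace.
Variables (K : fieldType) (V : vectType K) (U : {vspace V}).

Definition quotv : Type := {quot (pred_of_vspace U : zmodClosed V)}.

HB.instance Definition _ := EqQuotient.on quotv.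
HB.instance Definition _ := ZmodQuotient.on quotv.

Lemma eq_quotv (u v : V) : (\pi_quotv u == \pi_quotv v) = (u - v \in U).
Proof. exact/esym/idealrBE. Qed.

Definition quotv_scale (a : K) (x : quotv) : quotv := \pi_quotv (a *: repr x).

Fact pi_quotv_scale a v : quotv_scale a (\pi_quotv v) = \pi_quotv (a *: v).
Proof. by apply/eqP; rewrite eq_quotv -scalerBr memvZ // -eq_quotv reprK. Qed.

Fact quotv_scaleA a b x :
  quotv_scale a (quotv_scale b x) = quotv_scale (a * b) x.
Proof. by elim/quotW: x => v; rewrite (pi_quotv_scale b) !pi_quotv_scale scalerA. Qed.

Fact quotv_scale1 : left_id 1 quotv_scale.
Proof. by elim/quotW=> v; rewrite pi_quotv_scale scale1r. Qed.

Fact quotv_scaleDr : right_distributive quotv_scale +%R.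
Proof.
move=> a; elim/quotW=> u; elim/quotW=> v.
by rewrite -raddfD !pi_quotv_scale scalerDr raddfD.
Qed.

Fact quotv_scaleDl x : {morph quotv_scale^~ x : a b / a + b}.
Proof.
by elim/quotW: x => v a b; rewrite !pi_quotv_scale scalerDl raddfD.
Qed.

HB.instance Definition _ := GRing.Zmodule_isLmodule.Build K quotv
  quotv_scaleA quotv_scale1 quotv_scaleDr quotv_scaleDl.

Lemma quotv_eq0 (v : V) : (\pi_quotv v == 0) = (v \in U).
Proof. by rewrite -(raddf0 \pi_quotv) eq_quotv subr0. Qed.

End QuotientSpace.

Section DirectSum.
Variables (K : fieldType) (T : nat -> lmodType K).

Definition dprod : Type := forall i, T i.

HB.instance Definition _ := gen_eqMixin dprod.
HB.instance Definition _ := gen_choiceMixin dprod.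

Implicit Types f g h : dprod.

Let add f g : dprod := fun i => f i + g i.
Let opp f : dprod := fun i => - f i.
Let zero : dprod := fun i => 0.
Let scale (a : K) f : dprod := fun i => a *: f i.

Fact dprod_addA : associative add.
Proof. by move=> f g h; apply: functional_extensionality_dep => i; exact: addrA. Qed.
Fact dprod_addC : commutative add.
Proof. by move=> f g; apply: functional_extensionality_dep => i; exact: addrC. Qed.
Fact dprod_add0 : left_id zero add.
Proof. by move=> f; apply: functional_extensionality_dep => i; exact: add0r. Qed.
Fact dprod_addN : left_inverse zero opp add.
Proof. by move=> f; apply: functional_extensionality_dep => i; exact: addNr. Qed.

HB.instance Definition _ := GRing.isZmodule.Build dprod
  dprod_addA dprod_addC dprod_add0 dprod_addN.

Fact dprod_scaleA a b f : scale a (scale b f) = scale (a * b) f.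
Proof. by apply: functional_extensionality_dep => i; exact: scalerA. Qed.
Fact dprod_scale1 : left_id 1 scale.
Proof. by move=> f; apply: functional_extensionality_dep => i; exact: scale1r. Qed.
Fact dprod_scaleDr : right_distributive scale +%R.
Proof. by move=> a f g; apply: functional_extensionality_dep => i; exact: scalerDr. Qed.
Fact dprod_scaleDl f : {morph scale^~ f : a b / a + b}.
Proof. by move=> a b; apply: functional_extensionality_dep => i; exact: scalerDl. Qed.

HB.instance Definition _ := GRing.Zmodule_isLmodule.Build K dprod
  dprod_scaleA dprod_scale1 dprod_scaleDr dprod_scaleDl.

Lemma dprodDE f g i : (f + g) i = f i + g i. Proof. by []. Qed.
Lemma dprodZE a f i : (a *: f) i = a *: f i. Proof. by []. Qed.

Definition finsupp : {pred dprod} :=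
  [pred f : dprod | `[< exists N, forall i, (N <= i)%N -> f i = 0 >]].

Lemma finsuppP f :
  reflect (exists N, forall i, (N <= i)%N -> f i = 0) (f \in finsupp).
Proof. exact: asboolP. Qed.

Fact finsupp_submod_closed : submod_closed finsupp.
Proof.
split=> [|a f g /finsuppP[M fM] /finsuppP[N gN]]; apply/finsuppP.
  by exists 0%N.
exists (maxn M N) => i; rewrite geq_max => /andP[Mi Ni].
by rewrite dprodDE dprodZE fM // gN // scaler0 addr0.
Qed.

HB.instance Definition _ :=
  GRing.isSubmodClosed.Build K dprod finsupp finsupp_submod_closed.

Record dsum : Type := Dsum { dsum_val :> dprod; _ : dsum_val \in finsupp }.

HB.instance Definition _ := [isSub for dsum_val].
HB.instance Definition _ := [Choice of dsum by <:].
HB.instance Definition _ := [SubChoice_isSubZmodule of dsum by <:].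
HB.instance Definition _ := [SubZmodule_isSubLmodule of dsum by <:].

End DirectSum.

Section Algebra.
Variables (K : fieldType) (A : vectType K) (mul : {bilinear A -> A -> A}).
Implicit Types U V W : {vspace A}.

(* Same definition as prodv, which is only available for unital algebras. *)
Definition sprod U V : {vspace A} :=
  <<[seq mul u v | u <- vbasis U, v <- vbasis V]>>%VS.

Lemma memv_sprod U V : {in U & V, forall u v, mul u v \in sprod U V}.
Proof.
move=> u v Uu Vv.
rewrite (coord_vbasis Uu) (coord_vbasis Vv) linear_sumlz rpred_sum // => i _.
rewrite linear_sumr rpred_sum // => j _.
rewrite linearZl_LR linearZr_LR !memvZ // memv_span //.
by apply/allpairs_f; rewrite mem_nth // size_tuple.
Qed.

Lemma sprodP U V W :
  reflect {in U & V, forall u v, mul u v \in W} (sprod U V <= W)%VS.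
Proof.
apply: (iffP idP) => [sW u v Uu Vv | sW].
  by rewrite (subvP sW) // memv_sprod.
apply/span_subvP => _ /allpairsP[[u v] /= [Uu Vv ->]].
by rewrite sW // vbasis_mem.
Qed.

(* powers n = [:: A^1; ...; A^n] *)
Fixpoint powers (n : nat) : seq {vspace A} :=
  if n is i.+1 then
    let s := powers i in
    rcons s (if i is 0 then fullv
             else \sum_(k < i) sprod (nth fullv s k) (nth fullv s (i.-1 - k)))%VS
  else [::].

(* A^i for i > 0 (see apow1 and apowS); the value at 0 is junk. *)
Definition apow (i : nat) : {vspace A} := nth fullv (powers i) i.-1.

Lemma size_powers n : size (powers n) = n.
Proof. by elim: n => //= n IHn; rewrite size_rcons IHn. Qed.

Lemma nth_powers n i : (i < n)%N -> nth fullv (powers n) i = apow i.+1.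
Proof.
elim: n => // n IHn; rewrite ltnS leq_eqVlt => /orP[/eqP -> // | lt_in].
by rewrite /= nth_rcons size_powers lt_in IHn.
Qed.

Lemma apow1 : apow 1 = fullv. Proof. by []. Qed.

Lemma apowS i : (0 < i)%N ->
  apow i.+1 = (\sum_(1 <= k < i.+1) sprod (apow k) (apow (i.+1 - k)))%VS.
Proof.
case: i => // i _; rewrite /apow [powers _]/= nth_rcons size_rcons size_powers.
rewrite ltnn eqxx -/(powers i.+1) big_add1 big_mkord.
apply: eq_bigr => k _; have le_ki : (k <= i)%N by rewrite -ltnS.
by rewrite -!/(apow _) !nth_powers ?ltnS ?leq_subr // subSS subSn.
Qed.

Definition nilpotent_alg : Prop := exists2 i, (0 < i)%N & apow i = 0%VS.

Lemma sprod_apow i j : (0 < i)%N -> (0 < j)%N ->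
  (sprod (apow i) (apow j) <= apow (i + j))%VS.
Proof.
case: i j => // i [|j] // _ _; rewrite addnS [apow (_ + _).+1]apowS //.
have lt_i : (i < i.+1 + j)%N by rewrite addSn ltnS leq_addr.
rewrite big_add1 big_mkord; apply: (sumv_sup (Ordinal lt_i)) => //=.
by rewrite -addnS addKn.
Qed.

Lemma apow_sub i : (0 < i)%N -> (apow i.+1 <= apow i)%VS.
Proof.
elim/ltn_ind: i => -[|[|i]] // IH _; first by rewrite apow1 subvf.
rewrite apowS // big_add1 big_mkord; apply/subv_sumP => k _.
have le_ki : (k <= i.+1)%N by rewrite -ltnS.
apply/sprodP => u v uA vA; case: (posnP k) uA vA => [-> | k_gt0] uA vA.
  have IHi := IH i.+1 (ltnSn _) (ltn0Sn _).
  apply: (subvP (@sprod_apow 1 i.+1 _ _)) => //; apply: memv_sprod => //.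
  by apply: (subvP IHi); rewrite subn1 in vA.
have IHk := IH k le_ki k_gt0.
have: mul u v \in apow (k + (i.+2 - k)).
  apply: (subvP (sprod_apow k_gt0 _)); first by rewrite subn_gt0.
  by apply: memv_sprod; [apply: (subvP IHk) | rewrite subSS in vA].
by rewrite subnKC // leqW.
Qed.

(* A^i / A^{i+1}, with A^{i+1} seen as a subspace of A^i. *)
Definition next_in (i : nat) : {vspace subvs_of (apow i)} :=
  (linfun vsval @^-1: apow i.+1)%VS.

Definition grade (i : nat) : lmodType K := quotv (next_in i).

Definition gclass (i : nat) (v : A) : grade i :=
  \pi_(quotv (next_in i)) (vsproj (apow i) v).

(* The product A_i x A_j -> A_k, only meant for k = i + j: keeping k separate
   avoids casts, and the projection onto A^k hidden in gclass k is the identity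
   on A^i A^j. *)
Definition gprod (i j k : nat) (x : grade i) (y : grade j) : grade k :=
  gclass k (mul (vsval (repr x)) (vsval (repr y))).

Lemma gclass_eq0 i v : v \in apow i -> (gclass i v == 0) = (v \in apow i.+1).
Proof. by move=> vA; rewrite quotv_eq0 -memv_preim lfunE /= vsprojK. Qed.

Lemma gclassB i : {morph gclass i : u v / u - v}.
Proof. by move=> u v; rewrite /gclass linearB raddfB. Qed.

Lemma gclass_repr i (x : grade i) : gclass i (vsval (repr x)) = x.
Proof. by rewrite /gclass vsvalK reprK. Qed.

Lemma gprodE i j u v : (0 < i)%N -> (0 < j)%N ->
    u \in apow i -> v \in apow j ->
  gprod (i + j) (gclass i u) (gclass j v) = gclass (i + j) (mul u v).
Proof.
move=> i0 j0 uA vA; apply/eqP; rewrite -subr_eq0 -gclassB.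
set u' := vsval _; set v' := vsval _.
have u'A : u' \in apow i by exact: subvsP.
have v'A : v' \in apow j by exact: subvsP.
have Eu : u' - u \in apow i.+1.
  by rewrite -gclass_eq0 ?memvB // gclassB gclass_repr subrr.
have Ev : v' - v \in apow j.+1.
  by rewrite -gclass_eq0 ?memvB // gclassB gclass_repr subrr.
have E : mul u' v' - mul u v = mul (u' - u) v' + mul u (v' - v).
  by rewrite linearBl linearBr addrA subrK.
have EA : mul u' v' - mul u v \in apow (i + j).+1.
  rewrite E memvD //.
    by apply: (subvP (@sprod_apow i.+1 j _ _)) => //; apply: memv_sprod.
  by rewrite -addnS; apply: (subvP (@sprod_apow i j.+1 _ _)) => //; apply: memv_sprod.
rewrite gclass_eq0 //.
by apply: (subvP (apow_sub _)) EA; rewrite addn_gt0 i0.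
Qed.

Lemma gclass0 i : gclass i 0 = 0.
Proof. by apply/eqP; rewrite gclass_eq0 ?mem0v. Qed.

Lemma gprod0l i j y : (0 < i)%N -> (0 < j)%N ->
  gprod (i + j) (0 : grade i) (y : grade j) = 0.
Proof.
move=> i0 j0; rewrite -(gclass0 i) -[y]gclass_repr gprodE ?mem0v ?subvsP //.
by rewrite linear0l gclass0.
Qed.

Lemma gprod0r i j x : (0 < i)%N -> (0 < j)%N ->
  gprod (i + j) (x : grade i) (0 : grade j) = 0.
Proof.
move=> i0 j0; rewrite -(gclass0 j) -[x]gclass_repr gprodE ?mem0v ?subvsP //.
by rewrite linear0r gclass0.
Qed.

(* The index i of the direct sum stands for the degree i.+1. *)
Definition gr : lmodType K := dsum (fun i => grade i.+1).

Definition grmul_dprod (f g : gr) : dprod (fun i => grade i.+1) :=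
  fun k => \sum_(i < k.+1) \sum_(j < k.+1 | (i.+1 + j.+1 == k.+1)%N)
    gprod k.+1 (dsum_val f i) (dsum_val g j).

Fact grmul_finsupp f g : grmul_dprod f g \in @finsupp K (fun i => grade i.+1).
Proof.
case: f g => [f /= fS] [g /= gS].
have [M fM] := finsuppP _ fS; have [N gN] := finsuppP _ gS.
apply/finsuppP; exists (M + N).+1 => k le_k.
rewrite /grmul_dprod /= big1 // => i _; rewrite big1 // => j /eqP.
move: {i j}(nat_of_ord i) (nat_of_ord j) => i j Ek.
rewrite -Ek; case: (leqP M i) => [Mi | iM]; first by rewrite fM // gprod0l.
by rewrite gN ?gprod0r //; lia.
Qed.

Definition grmul (f g : gr) : gr := Dsum (grmul_finsupp f g).

Definition naturally_graded : Prop := alg_iso grmul mul.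

End Algebra.

Section CharacteristicSequence.
Variable K : fieldType.

Definition nilp_block (m : nat) : 'M[K]_m :=
  \matrix_(i, j) ((j : nat) == i.+1)%:R.

(* s lists in decreasing order the sizes of the Jordan blocks of the nilpotent
   endomorphism f (no s exists if f is not nilpotent). *)
Definition jordan_sizes (V : vectType K) (f : 'End(V)) (s : seq nat) : Prop :=
  [/\ sorted geq s, all (leq 1) s &
      exists2 e : (\sum_(k < size s) nth 0%N s k).-tuple V,
        basis_of fullv e &
        forall i, f (tnth e i) =
          \sum_j (\mxdiag_(k < size s) nilp_block (nth 0%N s k)) j i *: tnth e j].

Definition char_seq (A : vectType K) (mul : {bilinear A -> A -> A})
    (s : seq nat) : Prop :=
  (exists2 x, x \notin apow mul 2 & jordan_sizes (linfun (mul x)) s) /\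
  (forall x t, x \notin apow mul 2 -> jordan_sizes (linfun (mul x)) t ->
     ((t : seqlexi nat) <= (s : seqlexi nat))%O).

End CharacteristicSequence.

Section Models.
Variables (K : fieldType) (n : nat).

(* e_k, with 1 <= k <= n *)
Definition bvec (k : nat) : 'rV[K]_n := \row_(j < n) (j.+1 == k)%:R.

(* The bilinear product with e_i e_j = t i j for 1 <= i, j <= n. *)
Definition table_mul (t : nat -> nat -> 'rV[K]_n) (u v : 'rV[K]_n) : 'rV[K]_n :=
  \sum_(i < n) \sum_(j < n) (u 0 i * v 0 j) *: t i.+1 j.+1.

Lemma table_mulE t i j : (0 < i <= n)%N -> (0 < j <= n)%N ->
  table_mul t (bvec i) (bvec j) = t i j.
Proof.
case: i j => // i [|j] //= lt_i lt_j; rewrite /table_mul.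
rewrite (bigD1 (Ordinal lt_i)) //= [X in _ + X]big1 ?addr0 => [|k].
  rewrite (bigD1 (Ordinal lt_j)) //= [X in _ + X]big1 ?addr0 => [|l].
    by rewrite !mxE !eqxx mul1r scale1r.
  by rewrite -val_eqE /= !mxE !eqSS => /negPf->; rewrite mulr0 scale0r.
rewrite -val_eqE /= => /negPf ne_k; apply: big1 => l _.
by rewrite !mxE !eqSS ne_k mul0r scale0r.
Qed.

Definition mu22 (alpha : K) : 'rV[K]_n -> 'rV[K]_n -> 'rV[K]_n :=
  table_mul (fun i j =>
    if (i + j <= n - 2)%N then bvec (i + j)
    else if (i, j) == (1, n - 1)%N then bvec n
    else if (i, j) == (n - 1, 1)%N then alpha *: bvec n
    else 0).

Definition mu23 : 'rV[K]_n -> 'rV[K]_n -> 'rV[K]_n :=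
  table_mul (fun i j =>
    if (i + j <= n - 2)%N then bvec (i + j)
    else if (i, j) == (1, n - 1)%N then bvec n
    else if (i, j) == (n - 1, 1)%N then bvec n
    else if (i, j) == (n - 1, n - 1)%N then bvec n
    else 0).

Definition mu24 : 'rV[K]_n -> 'rV[K]_n -> 'rV[K]_n :=
  table_mul (fun i j =>
    if (i + j <= n - 2)%N then bvec (i + j)
    else if (i, j) == (1, n - 1)%N then bvec n
    else if (i, j) == (n - 1, n - 1)%N then bvec n
    else 0).

End Models.
Arguments mu22 {K} n alpha.
Arguments mu23 {K} n.
Arguments mu24 {K} n.

(* Main.v *)
(* Over any field the gradation gives projections p_i of A onto components V_i,
   with V_{k+1} spanned by V_1 V_k.  Let x have L_x of Jordan type (n-2, 2) and
   put e = p_1 x.  The rank of L_x forces dim V_1 <= 2 and V_2 = e V_1, hence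
   V_{k+1} = e V_k for all k; since L_x has index exactly n-2, the dimensions
   are 2, 2, 1, ..., 1 and the last component is V_{n-2} = <e^{n-2}>.  Choose y
   with V_1 = <e, y> and e^2 y = 0.  Writing y e and y y on e^2, e y,
   associativity and e^4 <> 0 kill both coefficients on e^2, so y e = a e y and
   y y = b e y.  Replacing (e, y) by (e + s y, t y) normalizes (a, b) to (a, 0),
   (1, 1) or (0, 1).  An isomorphism between two such models is triangular
   modulo A^2, and comparing e_n-coordinates separates the models. *)
From HB Require Import structures.
Require Import Defs.
From mathcomp Require Import all_boot all_order all_algebra.
From mathcomp Require Import reals complex.
From mathcomp Require Import zify ring boolp.

Set Implicit Arguments.
Unset Strict Implicit.
Unset Printing Implicit Defensive.

Import Order.TTheory GRing.Theory.
Local Open Scope ring_scope.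

(** * The gradation of a naturally graded algebra *)

Section Grading.
Variables (K : fieldType) (A : vectType K) (mul : {bilinear A -> A -> A}).

(* [p i] is the projection onto the component of degree [i >= 1]. *)
Record grading (p : nat -> 'End(A)) (N : nat) : Prop := Grading {
  grading0 : p 0%N = 0;
  grading_large : forall i, (N <= i)%N -> p i = 0;
  grading_orth : forall i j a, p i (p j a) = if i == j then p j a else 0;
  grading_sum : forall a, a = \sum_(i < N) p i a;
  grading_mul : forall i j a b,
    p (i + j)%N (mul (p i a) (p j b)) = mul (p i a) (p j b);
  grading_gen : forall k, (0 < k)%N ->
    (limg (p k.+1) <= sprod mul (limg (p 1%N)) (limg (p k)))%VS }.

(** The powers sum over all splittings of the exponent. By induction a left factor in [A^i] with i >
    1 is a sum of products [u1 u2] with [u2] in [A^(i-1)], and [(u1 u2) w = u1 (u2 w)] moves the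
    rest into the right factor. *)
Lemma apowS_sub : associative mul -> forall k, (0 < k)%N ->
  (apow mul k.+1 <= sprod mul fullv (apow mul k))%VS.
Proof.
move=> mulA; elim/ltn_ind => k IH k_gt0; rewrite apowS // big_add1 big_mkord.
apply/subv_sumP => -[i /= lt_ik] _; apply/sprodP => u w uA wA.
case: i lt_ik uA wA => [|i] lt_ik uA wA.
  by rewrite subn1 /= in wA; apply: memv_sprod => //; rewrite memvf.
have {uA}: u \in sprod mul fullv (apow mul i.+1).
  by apply: (subvP (IH _ _ _)) uA.
have wlinP: linear (mul^~ w) by move=> a x y; rewrite linearPl.
pose L := GRing.isLinear.Build _ _ _ _ _ wlinP.
pose f : {linear A -> A} := HB.pack (mul^~ w) L.
(* The [u] with [u w] in the target form a subspace, so products [u1 u2] suffice. *)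
suff: (sprod mul fullv (apow mul i.+1) <=
    linfun f @^-1: sprod mul fullv (apow mul k))%VS.
  by move=> /subvP sub /sub; rewrite -memv_preim lfunE.
apply/sprodP => u1 u2 _ u2A; rewrite -memv_preim lfunE /= -mulA.
apply: memv_sprod; first exact: memvf.
have ->: k = (i.+1 + (k.+1 - i.+2))%N by lia.
apply: (subvP (sprod_apow _ _ _)) => //; first by lia.
exact: memv_sprod.
Qed.

Let gr_deg i : lmodType K := grade mul i.+1.

Lemma gclassP i : linear (gclass mul i).
Proof.
move=> a u v; rewrite /gclass linearP raddfD; congr (_ + _).
exact/esym/pi_quotv_scale.
Qed.

Fact homog_finsupp i (v : A) : (fun k => if k == i then gclass mul k.+1 v else 0)
  \in @finsupp K gr_deg.
Proof. by apply/finsuppP; exists i.+1 => k; case: eqP => // ->; rewrite ltnn. Qed.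

Definition homog i v : gr mul := Dsum (homog_finsupp i v).

Lemma gr_ext (g h : gr mul) : (forall k, dsum_val g k = dsum_val h k) -> g = h.
Proof. by move=> gh; apply/val_inj/functional_extensionality_dep. Qed.

Lemma gr_linE a (g h : gr mul) k :
  dsum_val (a *: g + h) k = a *: dsum_val g k + dsum_val h k.
Proof. by []. Qed.

Fact homog_is_linear i : linear (homog i).
Proof.
move=> a u v; apply: gr_ext => k; rewrite gr_linE /=.
by case: eqP => _; rewrite ?gclassP // scaler0 addr0.
Qed.
HB.instance Definition _ i := GRing.isLinear.Build K A (gr mul) _ (homog i) (homog_is_linear i).

Definition lift_deg i (g : gr mul) : A := vsval (repr (dsum_val g i)).

Lemma lift_degP i g : lift_deg i g \in apow mul i.+1.
Proof. exact: subvsP. Qed.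

Lemma homog_lift i g k :
  dsum_val (homog i (lift_deg i g)) k = if k == i then dsum_val g k else 0.
Proof. by rewrite /=; case: eqP => // ->; rewrite gclass_repr. Qed.

Lemma gprod_eq0 i j k (x : grade mul i.+1) (y : grade mul j.+1) :
  (i.+1 + j.+1 == k.+1)%N -> x = 0 \/ y = 0 -> gprod k.+1 x y = 0.
Proof. by move/eqP<- => -[] ->; rewrite ?gprod0l ?gprod0r. Qed.

Lemma homog_mul i j u v : u \in apow mul i.+1 -> v \in apow mul j.+1 ->
  grmul (homog i u) (homog j v) = homog (i + j).+1 (mul u v).
Proof.
move=> uA vA; apply: gr_ext => k /=; rewrite /grmul_dprod /=.
case: (eqVneq k (i + j).+1) => [->|ne_k].
  have lt_i : (i < (i + j).+2)%N by lia.
  have lt_j : (j < (i + j).+2)%N by lia.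
  rewrite (bigD1 (Ordinal lt_i)) //= (bigD1 (Ordinal lt_j)) /=; last first.
    by rewrite addnS addSn.
  rewrite !eqxx !big1 ?addr0.
  - have := gprodE (ltn0Sn i) (ltn0Sn j) uA vA.
    by rewrite addSn addnS.
  - move=> i'; rewrite -val_eqE /= => /negPf ->; apply: big1 => j' Ek.
    by apply: gprod_eq0 => //; left.
  - move=> j' /andP[Ek]; rewrite -val_eqE /= => /negPf ->.
    by apply: gprod_eq0 => //; right.
apply: big1 => i' _; apply: big1 => j' Ek; apply: gprod_eq0 => //.
case: eqP => [ei|_]; last by left.
case: eqP => [ej|_]; last by right.
by case/eqP: ne_k; lia.
Qed.

Lemma gr_sumE (I : Type) (r : seq I) (P : pred I) (g : I -> gr mul) k :
  dsum_val (\sum_(i <- r | P i) g i) k = \sum_(i <- r | P i) dsum_val (g i) k.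
Proof. exact: (big_morph (fun h : gr mul => dsum_val h k)). Qed.

Lemma apow_leq i j : (0 < i <= j)%N -> (apow mul j <= apow mul i)%VS.
Proof.
case/andP=> i_gt0 /subnK <-; elim: (j - i)%N => [|m IH]; first exact: subvv.
by apply: subv_trans IH; rewrite addSn apow_sub // addn_gt0 i_gt0 orbT.
Qed.

(** The isomorphism transports the degree decomposition of gr A to A. Nilpotency bounds the degrees,
    and [apowS_sub] gives generation by degree 1. *)
Lemma natural_grading : associative mul -> nilpotent_alg mul ->
  naturally_graded mul -> exists p N, grading p N.
Proof.
move=> mulA [N N_gt0 AN] [f [g fK gK] fM].
have gP : linear g.
  by move=> a u v; apply: (can_inj fK); rewrite linearP !gK.
pose F i : A -> A := f \o homog i.
have FP i : linear (F i) by move=> a u v; rewrite /F /= !linearP.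
(* [lift_deg] chooses representatives and need not be linear; passing back to classes through [F]
   removes this dependence, so [q i] is linear. *)
pose q i a := F i (lift_deg i (g a)).
have qE i a : q i a = f (homog i (lift_deg i (g a))) by [].
have gq i j a : dsum_val (g (q i a)) j = if j == i then dsum_val (g a) j else 0.
  by rewrite qE fK homog_lift.
have g_ext a b : (forall k, dsum_val (g a) k = dsum_val (g b) k) -> a = b.
  by move=> ab; rewrite -[a]gK -[b]gK; congr (f _); apply: gr_ext.
have qP i : linear (q i).
  move=> a u v; apply: g_ext => k; rewrite gP gr_linE !gq gP gr_linE.
  by case: eqP => // _; rewrite scaler0 addr0.
pose qlin i : {linear A -> A} := HB.pack (q i) (GRing.isLinear.Build _ _ _ _ _ (qP i)).
pose Flin i : {linear A -> A} := HB.pack (F i) (GRing.isLinear.Build _ _ _ _ _ (FP i)).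
pose glin : {linear A -> gr mul} := HB.pack g (GRing.isLinear.Build _ _ _ _ _ gP).
have g0 : g 0 = 0 by exact: (linear0 glin).
have gsum m (x : 'I_m -> A) : g (\sum_i x i) = \sum_i g (x i).
  exact: (linear_sum glin).
have qF i v : q i (F i v) = F i v.
  by apply: g_ext => k; rewrite gq /F /= fK /=; case: eqP.
have FM i j u v : u \in apow mul i.+1 -> v \in apow mul j.+1 ->
    F (i + j).+1 (mul u v) = mul (F i u) (F j v).
  by move=> uA vA; rewrite /F /= -homog_mul // fM.
(* Index i of the direct sum is degree i+1, so the projections are shifted and degree 0 is empty. *)
pose p i : 'End(A) := if i is j.+1 then linfun (qlin j) else 0.
have pS i a : p i.+1 a = q i a by rewrite lfunE.
have q0 i : q i 0 = 0 by exact: (linear0 (qlin i)).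
have p0 a : p 0%N a = 0 by rewrite zero_lfunE.
have q_large i a : (N <= i.+1)%N -> q i a = 0.
  move=> le_Ni; rewrite qE.
  have : lift_deg i (g a) \in apow mul N.
    by apply: (subvP (apow_leq _)) (lift_degP _ _); rewrite N_gt0.
  by rewrite AN memv0 => /eqP->; rewrite !linear0.
exists p, N; split=> //.
- case=> [|i]; first by rewrite leqn0 => /eqP N0; rewrite N0 in N_gt0.
  by move=> le_Ni; apply/lfunP=> a; rewrite pS zero_lfunE q_large.
- case=> [|i] [|j] a; rewrite ?p0 ?pS ?q0 ?eqSS //.
  apply: g_ext => k; rewrite gq gq; case: (eqVneq i j) => [->|ne_ij].
    by rewrite gq; case: eqP.
  rewrite g0.
  by case: eqP => // ->; rewrite (negPf ne_ij).
- move=> a; case: N N_gt0 AN q_large => // N _ AN q_large.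
  rewrite big_ord_recl p0 add0r; under eq_bigr do rewrite pS.
  apply: g_ext => k; rewrite gsum gr_sumE.
  under eq_bigr do rewrite gq.
  case: (ltnP k N) => [lt_kN|le_Nk].
    rewrite (bigD1 (Ordinal lt_kN)) //= eqxx big1 ?addr0 // => i.
    by rewrite -val_eqE /= eq_sym => /negPf->.
  rewrite big1 => [|i _]; last by rewrite gtn_eqF // (leq_trans (ltn_ord i)).
  by have := gq k k a; rewrite eqxx q_large // g0.
- case=> [|i] [|j] a b; rewrite ?p0 ?linear0l ?linear0r ?linear0 //.
  by rewrite addSn addnS !pS -FM ?lift_degP // qF.
(* A component of degree k+2 has a representative in [A^(k+2)], hence in [A A^(k+1)]; [FM] turns
   each product there into a product of components of degrees 1 and k+1. *)
- case=> // k _; apply/subvP=> _ /memv_imgP[a _ ->]; rewrite pS.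
  suff /subvP sub : (apow mul k.+2 <= linfun (Flin k.+1) @^-1:
      sprod mul (limg (p 1%N)) (limg (p k.+1)))%VS.
    by have /sub := lift_degP k.+1 (g a); rewrite -memv_preim lfunE.
  apply: subv_trans (apowS_sub mulA (ltn0Sn k)) _; apply/sprodP => u v _ vA.
  rewrite -memv_preim lfunE /= -[k.+1]/((0 + k).+1) FM ?apow1 ?memvf //.
  by rewrite -[F 0%N u]qF -[F k v]qF -!pS memv_sprod // memv_img ?memvf.
Qed.
End Grading.

(** * Homogeneous components and leading terms of products *)

Section GradedAlgebra.
Variables (K : fieldType) (A : vectType K) (mul : {bilinear A -> A -> A}).
Variables (p : nat -> 'End(A)) (N : nat).
Hypothesis G : grading mul p N.

Local Notation V k := (limg (p k)).

Lemma memv_deg k v : (v \in V k) = (p k v == v).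
Proof.
apply/idP/eqP => [/memv_imgP[u _ ->] | <-]; last by rewrite memv_img ?memvf.
by rewrite (grading_orth G) eqxx.
Qed.

Lemma proj_deg k v : v \in V k -> p k v = v.
Proof. by rewrite memv_deg => /eqP. Qed.

Lemma memv_proj_deg k v : p k v \in V k.
Proof. by rewrite memv_img ?memvf. Qed.

Lemma proj_deg_neq i j v : v \in V j -> i != j -> p i v = 0.
Proof. by move=> /proj_deg<- /negPf ne; rewrite (grading_orth G) ne. Qed.

Lemma deg_mul i j u v : u \in V i -> v \in V j -> mul u v \in V (i + j).
Proof.
move=> /proj_deg<- /proj_deg<-; rewrite memv_deg.
by rewrite (grading_mul G).
Qed.

Lemma grading_sum_large M a : (N <= M)%N -> a = \sum_(i < M) p i a.
Proof.
move=> /subnKC<-; rewrite big_split_ord /= -(grading_sum G) big1 ?addr0 // => i _.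
by rewrite (grading_large G) ?leq_addr // zero_lfunE.
Qed.

Lemma proj_mul M k a b : (N <= M)%N -> p k (mul a b) =
  \sum_(i < M) \sum_(j < M) (if (i + j == k)%N then mul (p i a) (p j b) else 0).
Proof.
move=> le_NM; rewrite {1}(grading_sum_large a le_NM) {1}(grading_sum_large b le_NM).
rewrite linear_sumlz linear_sum; apply: eq_bigr => i _.
rewrite linear_sumr linear_sum; apply: eq_bigr => j _.
case: eqVneq => [<-|ne]; first exact: (grading_mul G).
by apply: proj_deg_neq (deg_mul (memv_proj_deg _ _) (memv_proj_deg _ _)) _; rewrite eq_sym.
Qed.

(** There is no degree 0, so if [b] starts in degree k, the only pair of degrees with sum at most
    k+1 that can contribute is (1, k). *)
Lemma proj_mul_low k a b : (0 < k)%N -> (forall j, (j < k)%N -> p j b = 0) ->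
  (forall j, (j < k.+1)%N -> p j (mul a b) = 0) /\
  p k.+1 (mul a b) = mul (p 1%N a) (p k b).
Proof.
move=> k_gt0 b_low; have le_NM : (N <= N + k.+2)%N by rewrite leq_addr.
have zero i j m : (i + j == m)%N -> (m <= k.+1)%N -> (i != 1%N) || (j != k) ->
    mul (p i a) (p j b) = 0.
  move=> /eqP Em le_m ne; have [lt_jk|] := ltnP j k.
    by rewrite b_low // linear0r.
  move=> ge_jk; have -> : i = 0%N by lia.
  by rewrite (grading0 G) zero_lfunE linear0l.
split=> [m lt_m | ]; rewrite (proj_mul _ _ _ le_NM).
  apply: big1 => i _; apply: big1 => j _; case: ifP => // Em.
  by apply: (zero _ _ _ Em); lia.
have lt1 : (1 < N + k.+2)%N by lia.
have ltk : (k < N + k.+2)%N by lia.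
rewrite (bigD1 (Ordinal lt1)) //= (bigD1 (Ordinal ltk)) //= add1n eqxx.
rewrite !big1 ?addr0 // => [i|j]; rewrite -val_eqE /= => ne.
  by apply: big1 => j _; case: ifP => // Em; apply: (zero _ _ _ Em) => //; rewrite ne.
by case: ifP => // Em; apply: (zero _ _ _ Em); rewrite // ne.
Qed.

(** Leading terms: this transfers information on the powers of L_x to the homogeneous element
    [p 1 x]. *)
Lemma proj_iter_mul k a b :
  (forall j, (j < k.+1)%N -> p j (iter k (mul a) b) = 0) /\
  p k.+1 (iter k (mul a) b) = iter k (mul (p 1%N a)) (p 1%N b).
Proof.
elim: k => [|k [IH0 IH1]] /=.
  by split=> // -[|//] _; rewrite (grading0 G) zero_lfunE.
by have [? ->] := proj_mul_low a (ltn0Sn k) IH0; rewrite IH1.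
Qed.

Lemma proj1_mul a b : p 1%N (mul a b) = 0.
Proof. by have [low _] := proj_iter_mul 1 a b; exact: (low 1%N). Qed.

Lemma proj2_mul a b : p 2%N (mul a b) = mul (p 1%N a) (p 1%N b).
Proof. by have [] := proj_iter_mul 1 a b. Qed.

Lemma dim_graded M : (N <= M)%N -> \dim {:A} = (\sum_(i < M) \dim (V i))%N.
Proof.
move=> le_NM; have VT : (\sum_(i < M) V i)%VS = fullv.
  apply/eqP; rewrite eqEsubv subvf; apply/subvP => a _.
  rewrite (grading_sum_large a le_NM) memv_sumr // => i _.
  exact: memv_proj_deg.
have <- : \dim (\sum_(i < M) V i) = \dim {:A} by rewrite VT.
suff D : directv (\sum_(i < M) V i)%VS by exact: (directvP D).
apply/directv_sum_independent => us usV us0 i _.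
have /(congr1 (p i)) := us0; rewrite linear_sum linear0 (bigD1 i) //=.
rewrite proj_deg ?usV // big1 ?addr0 // => j ne_ji.
by apply: proj_deg_neq (usV j isT) _; rewrite eq_sym.
Qed.

Lemma deg_sub_apow2 k : (1 < k)%N -> (V k <= apow mul 2)%VS.
Proof.
case: k => [|[|k]] // _; apply: subv_trans (grading_gen G (ltn0Sn k)) _.
apply/sprodP => u v _ _; apply: (subvP (@sprod_apow _ _ mul 1 1 _ _)) => //.
by rewrite memv_sprod ?apow1 ?memvf.
Qed.

Lemma proj1_neq0 x : x \notin apow mul 2 -> p 1%N x != 0.
Proof.
apply: contraNneq => p1x; rewrite (grading_sum G x).
apply: memv_suml => i _; case: (posnP i) => [-> | i_gt0].
  by rewrite (grading0 G) zero_lfunE mem0v.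
have [->|ne_i1] := eqVneq (i : nat) 1%N; first by rewrite p1x mem0v.
by apply: (subvP (deg_sub_apow2 _)) (memv_proj_deg _ _); lia.
Qed.

(** The image of L_x lies in the kernel of [p 1], of codimension dim V_1, so the rank bound gives
    dim V_1 <= 2. If dim V_1 <= 1, then V_1 is the line of [e = p 1 x] and V_2 is contained in V_1
    V_1 = e V_1. If dim V_1 = 2, the image is the whole kernel, so it contains V_2; compare
    components of degree 2. *)
Lemma deg2_sub x : x \notin apow mul 2 ->
    (\dim {:A} <= \dim (limg (linfun (mul x))) + 2)%N ->
  (\dim (V 1%N) <= 2)%N /\ (V 2%N <= linfun (mul (p 1%N x)) @: V 1%N)%VS.
Proof.
move=> x_gen rank_x; set e := p 1%N x.
have sub : (limg (linfun (mul x)) <= lker (p 1%N))%VS.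
  by apply/subvP => _ /memv_imgP[a _ ->]; rewrite memv_ker lfunE /= proj1_mul.
have dimK := limg_ker_dim (p 1%N) fullv; rewrite capfv in dimK.
have dim_sub := dimvS sub.
have d1_le2 : (\dim (V 1%N) <= 2)%N by lia.
split=> //; have [d1_le1|d1_gt1] := leqP (\dim (V 1%N)) 1.
  have V1 : V 1%N = <[e]>%VS.
    apply/eqP; rewrite eq_sym eqEdim -memvE memv_proj_deg dim_vline.
    by rewrite (proj1_neq0 x_gen).
  apply: subv_trans (grading_gen G (ltnSn 0)) _; apply/sprodP => u v.
  rewrite {1 2}V1 => /vlineP[s ->] /vlineP[t ->].
  rewrite linearZl_LR memvZ // -[mul e _](lfunE (mul e)) memv_img //.
  by rewrite memvZ // memv_proj_deg.
have limgE : limg (linfun (mul x)) = lker (p 1%N).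
  by apply/eqP; rewrite eqEdim sub /=; lia.
apply/subvP => v vV; have : v \in lker (p 1%N).
  by rewrite memv_ker (proj_deg_neq vV).
rewrite -limgE => /memv_imgP[a _]; rewrite lfunE /= => v_def.
by rewrite -(proj_deg vV) v_def proj2_mul -[mul _ _](lfunE (mul e)) memv_img ?memv_proj_deg.
Qed.

Hypothesis mulA : associative mul.

(** Induction through [u (e w') = (u e) w' = (e u') w' = e (u' w')], where [u e = e u'] comes from
    the hypothesis on V_2. *)
Lemma degS_sub e : e \in V 1%N -> (V 2%N <= linfun (mul e) @: V 1%N)%VS ->
  forall k, (V k.+2 <= linfun (mul e) @: V k.+1)%VS.
Proof.
move=> eV V2; elim=> // k IH; apply: subv_trans (grading_gen G (ltn0Sn _)) _.
apply/sprodP => u w uV /(subvP IH) /memv_imgP[w' w'V ->].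
have /(subvP V2)/memv_imgP[u' u'V] := deg_mul uV eV.
rewrite !lfunE /= mulA => ->; rewrite -mulA -[mul e _](lfunE (mul e)) memv_img //.
exact: (deg_mul u'V w'V).
Qed.

Lemma deg_iter e : (forall k, (V k.+2 <= linfun (mul e) @: V k.+1)%VS) ->
  forall k v, v \in V k.+1 -> exists2 u, u \in V 1%N & v = iter k (mul e) u.
Proof.
move=> VS; elim=> [|k IH] v vV; first by exists v.
have /(subvP (VS k))/memv_imgP[w /IH[u uV ->] ->] := vV.
by exists u; rewrite // lfunE.
Qed.
End GradedAlgebra.

(** * Jordan chains *)

(** [conform_mx] recasts the block to type [(p_ k, p_ l)]; its default 0 is not reached when k =
    l. *)
Lemma mxdiag_Rank (R : nmodType) p (p_ : 'I_p -> nat)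
    (B : forall k, 'M[R]_(p_ k)) k l (i : 'I_(p_ k)) (j : 'I_(p_ l)) :
  (\mxdiag_k B k) (tagnat.Rank k i) (tagnat.Rank l j) =
  if k == l then conform_mx 0 (B k) i j else 0.
Proof.
have /matrixP/(_ i j) := mxblockK (fun k l : 'I_p =>
  if k == l then conform_mx 0 (B k) else 0 : 'M_(p_ k, p_ l)) k l.
by rewrite mxE => ->; case: eqP; rewrite ?mxE.
Qed.

Section JordanChains.
Variables (K : fieldType) (V : vectType K).

(** The Jordan basis is reindexed by (block, position). The ones of [nilp_block] lie just above the
    diagonal, so [f] lowers the position by one and kills position 0. *)
Lemma jordan_chains (f : 'End(V)) s : jordan_sizes f s ->
  exists b : nat -> nat -> V,
  [/\ forall k j, (k < size s)%N -> (j < nth 0%N s k)%N -> b k j != 0,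
      forall k, (k < size s)%N -> f (b k 0%N) = 0,
      forall k j, (k < size s)%N -> (j.+1 < nth 0%N s k)%N ->
        f (b k j.+1) = b k j &
      forall U : {vspace V},
        (forall k j, (k < size s)%N -> (j < nth 0%N s k)%N -> b k j \in U) ->
        U = fullv].
Proof.
case=> _ /allP s_gt0 [e e_basis fe].
pose p_ := fun k : 'I_(size s) => nth 0%N s k.
(* Indices outside the blocks get the default value 0, which keeps [b] free of dependent types. *)
pose b k j := if insub k is Some k' then
  if insub j is Some j' then tnth e (@tagnat.Rank _ p_ k' j') else 0 else 0.
have bE k (j : 'I_(p_ k)) : b k j = tnth e (tagnat.Rank k j).
  by rewrite /b !valK.
have e_neq0 t : tnth e t != 0.
  by apply: (free_not0 (basis_free e_basis)); rewrite mem_tnth.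
have s_pos k : (k < size s)%N -> (0 < nth 0%N s k)%N.
  by move=> lt_k; apply: s_gt0; rewrite mem_nth.
have [D DE fb] : exists2 D : 'M_(_, _),
    forall l (i : 'I_(p_ l)) k (j : 'I_(p_ k)), D (tagnat.Rank l i) (tagnat.Rank k j) =
      ((l == k) && (j == i.+1 :> nat))%:R :> K
  & forall k (j : 'I_(p_ k)), f (b k j) = \sum_t D t (tagnat.Rank k j) *: tnth e t.
  exists (\mxdiag_k nilp_block K (p_ k)) => [l i k j|k j]; last by rewrite bE fe.
  rewrite mxdiag_Rank; case: eqP => //= E; subst l.
  by rewrite conform_mx_id mxE.
exists b; split.
- by move=> k j lt_k lt_j; rewrite (bE (Ordinal lt_k) (Ordinal lt_j)).
- move=> k lt_k; rewrite (fb (Ordinal lt_k) (Ordinal (s_pos k lt_k))).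
  apply: big1 => t _; rewrite -{1}[t]tagnat.sig2K DE andbF scale0r //.
- move=> k j lt_k lt_j; have lt_j' := ltnW lt_j.
  rewrite (fb (Ordinal lt_k) (Ordinal lt_j)) (bE (Ordinal lt_k) (Ordinal lt_j')).
  rewrite (bigD1 (tagnat.Rank (Ordinal lt_k) (Ordinal lt_j'))) //= [X in _ + X]big1 ?addr0.
    by rewrite DE !eqxx scale1r.
  move=> t; rewrite -[t]tagnat.sig2K DE -val_eqE tagnat.eq_Rank eqSS eq_sym [X in _ && X]eq_sym.
  by move/negPf ->; rewrite scale0r.
- move=> U bU; apply/eqP; rewrite eqEsubv subvf -(span_basis e_basis).
  apply/span_subvP => _ /tnthP[t ->]; rewrite -[t]tagnat.sig2K -bE.
  exact: bU.
Qed.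

(** The longest chain has length p, and its last vector reaches its first one after p-1 steps. The
    image contains everything in the chains except possibly the two last vectors, whence the rank
    bound. *)
Lemma jordan_two_blocks (f : 'End(V)) p q : (q <= p)%N ->
  jordan_sizes f [:: p; q] ->
  [/\ forall v, iter p f v = 0, exists v, iter p.-1 f v != 0
    & (\dim {:V} <= \dim (limg f) + 2)%N].
Proof.
move=> le_qp J; have [_ /allP/(_ p) p_gt0 _] := J.
have {}p_gt0 : (0 < p)%N by apply: p_gt0; rewrite mem_head.
have [b [b_neq0 b0 bS b_span]] := jordan_chains J.
have iterb k i j : (k < 2)%N -> (i + j < nth 0%N [:: p; q] k)%N ->
    iter i f (b k (i + j)%N) = b k j.
  elim: i => // i IH lt_k lt_ij; rewrite iterSr bS ?IH //; exact: ltnW.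
have le_np k : (k < 2)%N -> (nth 0%N [:: p; q] k <= p)%N by case: k => [|[|]].
have iter_lin i : linear (iter i f).
  by elim: i => [|i IH] a u v //=; rewrite IH linearP.
have iter0 i : iter i f 0 = 0 by elim: i => //= i ->; rewrite linear0.
split.
- move=> v.
  pose g : {linear V -> V} := HB.pack (iter p f) (GRing.isLinear.Build _ _ _ _ _ (iter_lin p)).
  suff /vspaceP/(_ v) : lker (linfun g) = fullv.
    by rewrite memvf memv_ker lfunE => /eqP.
  apply: b_span => k j lt_k lt_j; rewrite memv_ker lfunE /=.
  have -> : p = ((p - j.+1) + j.+1)%N by have := le_np k lt_k; lia.
  by rewrite iterD /= -[j in b k j]addn0 iterb ?addn0 // b0 // iter0.
- exists (b 0%N p.-1); rewrite -[X in b _ X]addn0 iterb ?addn0 ?prednK //.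
  exact: b_neq0.
- set U := (limg f + (<[b 0%N p.-1]> + <[b 1%N q.-1]>))%VS.
  suff EU : U = fullv.
    have <- : \dim U = \dim {:V} by rewrite EU.
    apply: leq_trans (dimv_add_leqif _ _) _; rewrite leq_add2l.
    apply: leq_trans (dimv_add_leqif _ _) _.
    by rewrite !dim_vline; do 2!case: eqP.
  apply: b_span => k j lt_k lt_j.
  case: (ltnP j.+1 (nth 0%N [:: p; q] k)) => [lt_j1|ge_j1].
    by rewrite -bS //; apply: (subvP (addvSl _ _)); rewrite memv_img ?memvf.
  apply: (subvP (addvSr _ _)).
  case: k lt_k lt_j ge_j1 => [|[|//]] /= _ lt_j ge_j1.
    by apply: (subvP (addvSl _ _)); rewrite (_ : j = p.-1) ?memv_line //; lia.
  by apply: (subvP (addvSr _ _)); rewrite (_ : j = q.-1) ?memv_line //; lia.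
Qed.
End JordanChains.

(** * The model algebras *)

Section Model.
Variables (K : fieldType) (n : nat).

(* [mu22], [mu23] and [mu24] are the cases (alpha, 0), (1, 1) and (0, 1). *)
Definition mu_model (alpha beta : K) : 'rV[K]_n -> 'rV[K]_n -> 'rV[K]_n :=
  table_mul (fun i j =>
    if (i + j <= n - 2)%N then bvec K n (i + j)
    else if (i, j) == (1, n - 1)%N then bvec K n n
    else if (i, j) == (n - 1, 1)%N then alpha *: bvec K n n
    else if (i, j) == (n - 1, n - 1)%N then beta *: bvec K n n
    else 0).

Lemma eq_table_mul (t t' : nat -> nat -> 'rV[K]_n) :
  t =2 t' -> table_mul t = table_mul t'.
Proof.
move=> tt'; apply/funext => u; apply/funext => v.
by apply: eq_bigr => i _; apply: eq_bigr => j _; rewrite tt'.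
Qed.

Lemma mu22E alpha : mu22 n alpha = mu_model alpha 0.
Proof. by apply: eq_table_mul => i j; rewrite scale0r if_same. Qed.

Lemma mu23E : mu23 n = mu_model 1 1.
Proof. by apply: eq_table_mul => i j; rewrite scale1r. Qed.

Lemma mu24E : mu24 n = mu_model 0 1.
Proof.
apply: eq_table_mul => i j; rewrite scale1r scale0r.
case: ifP => // _; case: eqP => // ne1.
(* The pairs (n-1, 1) and (n-1, n-1) coincide only if n-1 = 1, and then the pair is (1, n-1),
   excluded by [ne1]. *)
have [[Ei Ej]|//] := (i, j) =P ((n - 1)%N, 1%N).
by case: eqP => // -[_ Ej']; case: ne1; congr pair; lia.
Qed.

Lemma bvec_sum (u : 'rV[K]_n) : u = \sum_i u 0 i *: bvec K n i.+1.
Proof.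
apply/rowP => k; rewrite summxE (bigD1 k) //= !mxE eqxx mulr1 big1 ?addr0 // => i.
by rewrite !mxE eqSS val_eqE eq_sym => /negPf->; rewrite mulr0.
Qed.

(** The map sending e_k to [b k] is onto because the [b k] span, hence bijective by dimension; the
    isomorphism is its inverse. *)
Lemma alg_iso_table (A : vectType K) (mul : {bilinear A -> A -> A})
    (t : nat -> nat -> 'rV[K]_n) (b : nat -> A) :
    \dim {:A} = n ->
    (forall U : {vspace A}, (forall k, (0 < k <= n)%N -> b k \in U) -> U = fullv) ->
    (forall i j, (0 < i <= n)%N -> (0 < j <= n)%N ->
      mul (b i) (b j) = \sum_k t i j 0 k *: b k.+1) ->
  alg_iso mul (table_mul t).
Proof.
move=> dimA b_span b_mul.
pose g0 (u : 'rV[K]_n) : A := \sum_k u 0 k *: b k.+1.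
have g0P : linear g0.
  move=> a u v; rewrite /g0 scaler_sumr -big_split; apply: eq_bigr => k _.
  by rewrite !mxE scalerDl scalerA.
pose glin : {linear 'rV[K]_n -> A} := HB.pack g0 (GRing.isLinear.Build _ _ _ _ _ g0P).
pose g := linfun glin.
have gE u : g u = \sum_k u 0 k *: b k.+1 by rewrite lfunE.
have gb k : (0 < k <= n)%N -> g (bvec K n k) = b k.
  case: k => // k /= lt_k; rewrite gE (bigD1 (Ordinal lt_k)) //= mxE eqxx scale1r.
  rewrite big1 ?addr0 // => i; rewrite mxE eqSS -val_eqE /= => /negPf ->.
  by rewrite scale0r.
have gM u v : g (table_mul t u v) = mul (g u) (g v).
  rewrite [g u]gE linear_sumlz [RHS]/= /table_mul linear_sum.
  apply: eq_bigr => i _; rewrite linearZl_LR linear_sum [g v]gE linear_sumr scaler_sumr.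
  apply: eq_bigr => j _; rewrite !linearZ /= linearZ_LR scalerA /=; congr (_ *: _).
  by rewrite b_mul ?gE // /= ltn_ord.
have gT : limg g = fullv.
  by apply: b_span => k k_n; rewrite -gb // memv_img ?memvf.
have gker : lker g == 0%VS.
  rewrite -dimv_eq0; have := limg_ker_dim g fullv.
  by rewrite gT capfv dimA dimvf /dim /= mul1n; lia.
exists (g^-1)%VF.
  exists g => [x | u]; last exact: lker0_lfunK.
  by rewrite limg_lfunVK // gT memvf.
have g_inj : injective g by apply/lker0P.
move=> x y; apply: g_inj; rewrite gM.
by rewrite !limg_lfunVK ?gT ?memvf.
Qed.

(* [e], [y] correspond to e_1, e_{n-1}. *)
Record model_gens (A : vectType K) (mul : {bilinear A -> A -> A})
    (e y : A) (a b : K) : Prop := ModelGens {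
  gens_eey : mul e (mul e y) = 0;
  gens_ye : mul y e = a *: mul e y;
  gens_yy : mul y y = b *: mul e y;
  gens_nilp : iter (n - 2) (mul e) e = 0;
  gens_span : forall U : {vspace A},
    (forall k, (k < n - 2)%N -> iter k (mul e) e \in U) ->
    y \in U -> mul e y \in U -> U = fullv }.

(** * Change of generators and isomorphism with a model *)

Section ModelGens.
Variables (A : vectType K) (mul : {bilinear A -> A -> A}) (e y : A) (a b : K).
Hypotheses (mulA : associative mul) (gens : model_gens mul e y a b).

Let pw k := iter k (mul e) e.

Let mDl (u v w : A) : mul (u + v) w = mul u w + mul v w.
Proof. exact: linearDl. Qed.
Let mDr (u v w : A) : mul w (u + v) = mul w u + mul w v.
Proof. exact: linearD. Qed.
Let mZl c (u v : A) : mul (c *: u) v = c *: mul u v.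
Proof. exact: linearZl_LR. Qed.
Let mZr c (u v : A) : mul u (c *: v) = c *: mul u v.
Proof. exact: linearZ. Qed.
Let bilinE := (mDl, mDr, mZl, mZr).

Lemma mul_ey_pow k : mul (mul e y) (pw k) = 0.
Proof.
have ze : mul (mul e y) e = 0.
  by rewrite -mulA (gens_ye gens) linearZ /= (gens_eey gens) scaler0.
by case: k => //= k; rewrite mulA ze linear0l.
Qed.

Lemma mul_y_powS k : mul y (pw k.+1) = 0.
Proof. by rewrite /= mulA (gens_ye gens) linearZl_LR /= mul_ey_pow scaler0. Qed.

Lemma mul_y_ey : mul y (mul e y) = 0.
Proof.
rewrite mulA (gens_ye gens) linearZl_LR /= -mulA (gens_yy gens) linearZ /=.
by rewrite (gens_eey gens) !scaler0.
Qed.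

(** With e' = e + s y and y' = t y one finds e'y' = t (1 + s b) ey, y'e' = t (a + s b) ey and y'y' =
    t^2 b ey; the two equations on a' and b' compare these coefficients. *)
Lemma model_gens_change s t a' b' : (5 < n)%N -> t != 0 -> 1 + s * b != 0 ->
    a' * (1 + s * b) = a + s * b -> b' * (1 + s * b) = t * b ->
  model_gens mul (e + s *: y) (t *: y) a' b'.
Proof.
move=> n_gt5 t_neq0 sb_neq0 a'E b'E; set e' := e + _; set y' := t *: y.
have e'y' : mul e' y' = (t * (1 + s * b)) *: mul e y.
  rewrite /e' /y' !bilinE (gens_yy gens).
  by rewrite !scalerA -scalerDl; congr (_ *: _); ring.
have e'z : mul e' (mul e y) = 0.
  by rewrite /e' !bilinE (gens_eey gens) mul_y_ey scaler0 addr0.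
have [c e'e'] : exists c, mul e' e' = mul e e + c *: mul e y.
  exists (s + s * (a + s * b)); rewrite /e' !bilinE.
  rewrite (gens_ye gens) (gens_yy gens) !scalerA -addrA -!scalerDl.
  by congr (_ + _ *: _); ring.
(* The correction [c ey] to the square is killed by e', so the powers of e' and e agree from the
   third on. *)
have pw' k : iter k.+2 (mul e') e' = pw k.+2.
  elim: k => [|k IH]; last first.
    by rewrite iterS IH /e' !bilinE mul_y_powS scaler0 addr0.
  rewrite /= e'e' mDr mZr e'z scaler0 addr0 /e' !bilinE.
  by rewrite (mul_y_powS 0) scaler0 addr0.
split.
- by rewrite e'y' mZr e'z scaler0.
- rewrite e'y' /y' !bilinE (gens_ye gens) (gens_yy gens).
  by rewrite !scalerA -scalerDl; congr (_ *: _); rewrite mulrCA a'E; ring.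
- rewrite e'y' /y' !bilinE (gens_yy gens) !scalerA.
  by congr (_ *: _); rewrite mulrCA b'E; ring.
- have -> : (n - 2 = (n - 4).+2)%N by lia.
  by rewrite pw' /pw (_ : (n - 4).+2 = n - 2)%N ?(gens_nilp gens) //; lia.
- move=> U pwU y'U e'y'U.
  have yU : y \in U.
    by rewrite -[y]scale1r -(mulVf t_neq0) -scalerA memvZ.
  have zU : mul e y \in U.
    rewrite -[mul e y]scale1r -(mulVf (mulf_neq0 t_neq0 sb_neq0)) -scalerA memvZ //.
    by rewrite -e'y'.
  apply: (gens_span gens) => // -[|[|k]] lt_k.
  + have := pwU 0%N lt_k; rewrite /= /e' => eU.
    by rewrite -[e](addrK (s *: y)) memvB // memvZ.
  + have := pwU 1%N lt_k; rewrite /= e'e' => eeU.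
    by rewrite -[mul e e](addrK (c *: mul e y)) memvB // memvZ.
  + by have := pwU _ lt_k; rewrite pw'.
Qed.

Lemma alg_iso_mu_model : \dim {:A} = n -> (5 < n)%N -> alg_iso mul (mu_model a b).
Proof.
move=> dimA n_gt5; pose z := mul e y.
have eey := gens_eey gens; have ye := gens_ye gens; have yy := gens_yy gens.
have pwD i j : mul (pw i) (pw j) = pw (i + j).+1.
  by elim: i => //= i IH; rewrite -mulA IH.
have pw_large k : (n - 2 <= k)%N -> pw k = 0.
  move=> /subnK <-; rewrite /pw iterD (gens_nilp gens).
  by elim: (k - _)%N => //= m ->; rewrite linear0r.
have zpw i : mul z (pw i) = 0 by exact: mul_ey_pow.
have yz : mul y z = 0 by exact: mul_y_ey.
have ypw i : mul y (pw i.+1) = 0 by exact: mul_y_powS.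
have zy : mul z y = 0 by rewrite /z -mulA yy linearZ /= eey scaler0.
have zz : mul z z = 0 by rewrite {1}/z -mulA yz linear0r.
have pwz i : mul (pw i) z = 0 by elim: i => //= i IH; rewrite -mulA IH linear0r.
have pwy i : mul (pw i.+1) y = 0.
  by elim: i => [|i IH] /=; rewrite -mulA // IH linear0r.
(* [pw k.-1] is e^k, so the basis is e, ..., e^(n-2), y, ey. *)
pose c k := if k == n then z else if k == (n - 1)%N then y else pw k.-1.
have cpw k : (k <= n - 2)%N -> c k = pw k.-1.
  by move=> le_k; rewrite /c !ltn_eqF //; lia.
have cy : c (n - 1)%N = y by rewrite /c eqxx ltn_eqF //; lia.
have cz : c n = z by rewrite /c eqxx.
have coef k : (0 < k <= n)%N -> \sum_l bvec K n k 0 l *: c l.+1 = c k.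
  case: k => // k /= lt_k; rewrite (bigD1 (Ordinal lt_k)) //= mxE eqxx scale1r.
  rewrite big1 ?addr0 // => i; rewrite mxE eqSS -val_eqE /= => /negPf ->.
  by rewrite scale0r.
have coefZ x k : (0 < k <= n)%N -> \sum_l (x *: bvec K n k) 0 l *: c l.+1 = x *: c k.
  move=> k_n; rewrite -coef // scaler_sumr; apply: eq_bigr => l _.
  by rewrite mxE scalerA.
have coef0 : \sum_l (0 : 'rV[K]_n) 0 l *: c l.+1 = 0.
  by apply: big1 => l _; rewrite mxE scale0r.
have k_cases k : (0 < k <= n)%N -> [\/ (0 < k <= n - 2)%N, k = (n - 1)%N | k = n].
  move=> k_n; have [->|] := k =P n; first by constructor 3.
  have [->|] := k =P (n - 1)%N; first by constructor 2.
  by move=> *; constructor 1; lia.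
apply: (alg_iso_table (b := c)) => // [U cU | i j i_n j_n].
  apply: (gens_span gens) => [k lt_k | |].
  - by rewrite -[k]/(k.+1.-1) -[iter _ _ _]/(pw _) -cpw //; apply: cU; lia.
  - by rewrite -cy; apply: cU; lia.
  - by rewrite -/z -cz; apply: cU; lia.
case: ifP => [le_ij | gt_ij].
  rewrite coef; last by lia.
  rewrite !cpw; try lia.
  by rewrite pwD; congr pw; lia.
have n_n : (0 < n <= n)%N by lia.
have c1 : c 1%N = e by rewrite cpw //; lia.
case: eqP => [[-> ->]|ne1]; first by rewrite coef // cz c1 cy.
case: eqP => [[-> ->]|ne2]; first by rewrite coefZ // cz c1 cy.
case: eqP => [[-> ->]|ne3]; first by rewrite coefZ // cz cy.
rewrite coef0.
(* Products absent from the table vanish: e^k has exponent above n-2, y meets a power e^k with k >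
   1, or a factor is ey. *)
have [ik|Ei|Ei] := k_cases i i_n; have [jk|Ej|Ej] := k_cases j j_n;
  rewrite ?Ei ?Ej ?cy ?cz ?cpw //; try (by lia).
- by rewrite pwD pw_large //; lia.
- case: i ik ne1 {i_n gt_ij ne2 ne3} => [|[|i]] // _; last by rewrite pwy.
  by rewrite Ej => -[].
- case: j jk ne2 {j_n gt_ij ne1 ne3} => [|[|j]] // _; last by rewrite ypw.
  by rewrite Ei => -[].
- by case: ne3; rewrite Ei Ej.
Qed.

End ModelGens.

(** * Coordinates of products and separation of the models *)

Lemma table_mul_coord (t : nat -> nat -> 'rV[K]_n) u v k :
  (table_mul t u v) 0 k = \sum_i \sum_j u 0 i * v 0 j * t i.+1 j.+1 0 k.
Proof.
rewrite summxE; apply: eq_bigr => i _; rewrite summxE.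
by apply: eq_bigr => j _; rewrite mxE.
Qed.

Lemma sum_pair_delta (u v : 'rV[K]_n) (a b : 'I_n) c :
  \sum_i \sum_j u 0 i * v 0 j * (((i == a) && (j == b))%:R * c) = u 0 a * v 0 b * c.
Proof.
rewrite (bigD1 a) //= (bigD1 b) //= !eqxx mul1r [X in _ + X + _]big1.
  rewrite [X in _ + X]big1 ?addr0 // => i /negPf->.
  by apply: big1 => j _; rewrite mul0r mulr0.
by move=> j /negPf->; rewrite andbF mul0r mulr0.
Qed.

(** [s] lists the triples (i, j, c) of zero-based positions and coefficients that make up coordinate
    k of the table, so that coordinate of a product becomes a short sum. *)
Lemma table_mul_delta (t : nat -> nat -> 'rV[K]_n) u v k
    (s : seq ('I_n * 'I_n * K)) :
  (forall i j : 'I_n, t i.+1 j.+1 0 k =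
     \sum_(p <- s) ((i == p.1.1) && (j == p.1.2))%:R * p.2) ->
  (table_mul t u v) 0 k = \sum_(p <- s) u 0 p.1.1 * v 0 p.1.2 * p.2.
Proof.
move=> tE; rewrite table_mul_coord.
under eq_bigr => i _ do under eq_bigr => j _ do rewrite tE mulr_sumr.
under eq_bigr => i _ do rewrite exchange_big /=.
rewrite exchange_big /=; apply: eq_bigr => -[[a b] c] _; exact: sum_pair_delta.
Qed.

Section Coordinates.
Hypothesis n_gt5 : (5 < n)%N.
(** Ordinals are zero-based: [o1], [o2], [o3], [oy], [oz] are the coordinates of e_1, e_2, e_3,
    e_(n-1), e_n. *)
Let o1 : 'I_n := Ordinal (ltn_trans (isT : 0 < 5)%N n_gt5).
Let o2 : 'I_n := Ordinal (ltn_trans (isT : 1 < 5)%N n_gt5).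
Let o3 : 'I_n := Ordinal (ltn_trans (isT : 2 < 5)%N n_gt5).
Fact penult_subproof : (n - 2 < n)%N. Proof. by lia. Qed.
Fact last_subproof : (n - 1 < n)%N. Proof. by lia. Qed.
Let oy : 'I_n := Ordinal penult_subproof.
Let oz : 'I_n := Ordinal last_subproof.

Variables a b : K.
Implicit Types u v : 'rV[K]_n.

Local Ltac coord_table :=
  move=> [i lt_i] [j lt_j]; rewrite ?big_cons big_nil -?val_eqE /= ?xpair_eqE;
  repeat case: ifP => ?; rewrite !mxE /=;
  repeat match goal with |- context [(?x == ?y :> nat)] => case: (x =P y) => ? end;
  rewrite /= ?mul1r ?mul0r ?mulr1 ?mulr0 ?addr0 ?add0r //; exfalso; lia.

Lemma mu_model_coord1 u v : mu_model a b u v 0 o1 = 0.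
Proof. by rewrite (@table_mul_delta _ _ _ _ [::]) ?big_nil //; coord_table. Qed.

Lemma mu_model_coord2 u v : mu_model a b u v 0 o2 = u 0 o1 * v 0 o1.
Proof.
rewrite (@table_mul_delta _ _ _ _ [:: (o1, o1, 1)]); last by coord_table.
by rewrite big_seq1 mulr1.
Qed.

Lemma mu_model_coord3 u v :
  mu_model a b u v 0 o3 = u 0 o1 * v 0 o2 + u 0 o2 * v 0 o1.
Proof.
rewrite (@table_mul_delta _ _ _ _ [:: (o1, o2, 1); (o2, o1, 1)]); last by coord_table.
by rewrite !big_cons big_nil !mulr1 addr0.
Qed.

Lemma mu_model_coord_penult u v : mu_model a b u v 0 oy = 0.
Proof. by rewrite (@table_mul_delta _ _ _ _ [::]) ?big_nil //; coord_table. Qed.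

Lemma mu_model_coord_last u v : mu_model a b u v 0 oz =
  u 0 o1 * v 0 oy + a * (u 0 oy * v 0 o1) + b * (u 0 oy * v 0 oy).
Proof.
rewrite (@table_mul_delta _ _ _ _ [:: (o1, oy, 1); (oy, o1, a); (oy, oy, b)]).
  by rewrite !big_cons big_nil mulr1 addr0 addrA ![_ * a]mulrC ![_ * b]mulrC.
coord_table.
Qed.

End Coordinates.

(* [x] is the e_1-coordinate of the image of e_1, and [(y, d)] are the
   e_{n-1}-coordinates of the images of e_1 and e_{n-1}. *)
Lemma mu_model_iso_params (a b a' b' : K) : (5 < n)%N ->
  alg_iso (mu_model a b) (mu_model a' b') -> exists x y d,
  [/\ x != 0, d != 0, a * (x + b' * y) = a' * x + b' * y
    & b * (x + b' * y) = b' * d].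
Proof.
move=> n_gt5 [f [g fK gK] fM].
pose o1 := Ordinal (ltn_trans (isT : 0 < 5)%N n_gt5).
pose o2 := Ordinal (ltn_trans (isT : 1 < 5)%N n_gt5).
pose oy := Ordinal (penult_subproof n_gt5).
have X1 := mu_model_coord1 n_gt5 a' b'.
have X2 := mu_model_coord2 n_gt5 a' b'.
have X3 := mu_model_coord3 n_gt5 a' b'.
have Xy := mu_model_coord_penult n_gt5 a' b'.
have Xz := mu_model_coord_last n_gt5 a' b'.
rewrite -/o1 -/o2 -/oy in X1 X2 X3 Xy Xz.
pose e := bvec K n 1; pose y := bvec K n (n - 1); pose z := bvec K n n.
have n_n : (0 < n <= n)%N by lia.
have ey : mu_model a b e y = z.
  by rewrite /mu_model table_mulE; try lia; rewrite eqxx ifF //; lia.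
have ye : mu_model a b y e = a *: z.
  rewrite /mu_model table_mulE; try lia; rewrite eqxx ifF; last by lia.
  by rewrite ifF // xpair_eqE; lia.
have yy : mu_model a b y y = b *: z.
  rewrite /mu_model table_mulE; try lia; rewrite eqxx ifF; last by lia.
  by rewrite !ifF // xpair_eqE; lia.
have ez : mu_model a b e z = 0.
  rewrite /mu_model table_mulE; try lia; rewrite ifF; last by lia.
  by rewrite !ifF // xpair_eqE; lia.
have f_prod u v k : f (mu_model a b u v) 0 k = mu_model a' b' (f u) (f v) 0 k.
  by rewrite fM.
(* Every basis vector other than e_1 and e_(n-1) is a product, and products have zero coordinates on
   these two. *)
have fb i : i != o1 -> i != oy -> f (bvec K n i.+1) 0 o1 = 0 /\ f (bvec K n i.+1) 0 oy = 0.
  rewrite -!val_eqE /= => ne_i1 ne_iy.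
  suff [u [v ->]] : exists u v, bvec K n i.+1 = mu_model a b u v by rewrite !fM X1 Xy.
  have [lt_i|ge_i] := ltnP i (n - 2).
    exists e, (bvec K n i); rewrite /mu_model table_mulE; try lia.
    by rewrite ifT //; lia.
  by exists e, y; rewrite ey; congr bvec; have := ltn_ord i; lia.
have ne_o : oy != o1 by rewrite -val_eqE /=; lia.
have fcoord u k : k = o1 \/ k = oy ->
    f u 0 k = u 0 o1 * f e 0 k + u 0 oy * f y 0 k.
  move=> kE; rewrite {1}[u]bvec_sum linear_sum summxE (bigD1 o1) //= (bigD1 oy) //=.
  rewrite big1 ?addr0 => [|i /andP[i1 iy]].
    rewrite !linearZ !mxE (_ : (n - 2).+1 = n - 1)%N //; lia.
  rewrite linearZ mxE; have [E1 E2] := fb i i1 iy.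
  by case: kE => ->; rewrite ?E1 ?E2 mulr0.
have fz k : f z 0 k = mu_model a' b' (f e) (f y) 0 k by rewrite -ey fM.
set x := f e 0 o1; set c := f y 0 o1; set s := f e 0 oy; set d := f y 0 oy.
(* The e_3-coordinate of f(e) f(z) = f(e z) = 0, where f(z) = f(e) f(y) has e_2-coordinate x c. *)
have xxc : x * (x * c) = 0.
  have := f_prod e z; rewrite ez linear0 => /(_ (Ordinal (ltn_trans (isT : 2 < 5)%N n_gt5))).
  by rewrite mxE X3 !fz X1 X2 mulr0 addr0.
(* If x = 0, the e_2-coordinates of f(y) f(y) = b f(z) give c^2 = b x c = 0. *)
have c0 : c = 0.
  have [x0|x_neq0] := eqVneq x 0; last first.
    by move/eqP: xxc; rewrite !mulf_eq0 (negPf x_neq0) /= => /eqP.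
  have := f_prod y y o2; rewrite yy linearZ mxE fz !X2 -/x -/c x0 mul0r mulr0.
  by move/esym/eqP; rewrite mulf_eq0 orbb => /eqP.
have x_neq0 : x != 0.
  have := fcoord (g (bvec K n 1)) o1 (or_introl erefl); rewrite gK mxE /= -/x -/c c0 mulr0 addr0.
  by apply: contra_eq_neq => ->; rewrite mulr0 oner_eq0.
(* The preimage [u] of e_(n-1) has no e_1-coordinate, since x <> 0 = c; its e_(n-1)-coordinate times
   d is then 1. *)
have d_neq0 : d != 0.
  pose u := g (bvec K n (n - 1)).
  have := fcoord u o1 (or_introl erefl); have := fcoord u oy (or_intror erefl).
  rewrite gK !mxE -/x -/c -/s -/d c0 mulr0 addr0 /= (_ : (n - 2).+1 = n - 1)%N ?eqxx; last by lia.
  rewrite (_ : 1 == n - 1 = false)%N; last by lia.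
  move=> E /esym/eqP; rewrite mulf_eq0 (negPf x_neq0) orbF => /eqP u0.
  move/esym: E; rewrite u0 mul0r add0r.
  by apply: contra_eq_neq => ->; rewrite mulr0 eq_sym oner_eq0.
pose oz := Ordinal (last_subproof n_gt5).
have Z1 : f z 0 oz = d * (x + b' * s).
  by rewrite fz Xz -/x -/c -/s -/d c0; ring.
(* Compare e_n-coordinates in f(y) f(e) = a f(z) and f(y) f(y) = b f(z), then cancel d. *)
exists x, s, d; split=> //; apply: (mulfI d_neq0).
  have := f_prod y e oz; rewrite ye linearZ mxE Z1 Xz -/x -/c -/s -/d c0.
  by rewrite mulrCA => ->; ring.
have := f_prod y y oz; rewrite yy linearZ mxE Z1 Xz -/x -/c -/s -/d c0.
by rewrite mulrCA => ->; ring.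
Qed.
End Model.

(** * Classification *)

(** The n-2 positive terms sum to n. Were d 1 <= 1, the sum would be at most n-2. *)
Lemma dims_2211 (d : nat -> nat) (M n : nat) : (5 < n)%N -> (n - 1 <= M)%N ->
    d 0%N = 0%N -> (d 1%N <= 2)%N ->
    (forall k, (d k.+2 <= d k.+1)%N) -> (0 < d (n - 2))%N ->
    (forall k, (n - 1 <= k)%N -> d k = 0%N) -> (\sum_(i < M) d i)%N = n ->
  d 1%N = 2 /\ forall k, (2 < k)%N -> (d k <= 1)%N.
Proof.
move=> n_gt5 le_nM d0 d1 dS dn2 d_large sum_d.
have d_mono i j : (0 < i)%N -> (i <= j)%N -> (d j <= d i)%N.
  move=> i_gt0 /subnK <-; elim: (j - i)%N => // m; rewrite addSn.
  by apply: leq_trans; case: i i_gt0 => // i _; rewrite addnS.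
have tail : (\sum_(4 <= i < n - 1) 1 <= \sum_(4 <= i < n - 1) d i <= \sum_(4 <= i < n - 1) d 3)%N.
  rewrite !big_nat; apply/andP; split; apply: leq_sum => i /andP[i4 lt_i].
    by apply: leq_trans dn2 _; apply: d_mono; lia.
  by apply: d_mono; lia.
move: tail; rewrite !sum_nat_const_nat muln1 => /andP[tail_ge tail_le].
have sum_n1 : (\sum_(0 <= i < n - 1) d i)%N = n.
  rewrite -[RHS]sum_d -(big_mkord xpredT) [RHS](@big_cat_nat _ _ _ (n - 1)) //=.
  rewrite [X in _ = (_ + X)%N]big_nat [X in _ = (_ + X)%N]big1 ?addn0 //.
  by move=> i /andP[le_i _]; apply: d_large.
have E : (d 0 + (d 1 + (d 2 + (d 3 + \sum_(4 <= i < n - 1) d i))))%N = n.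
  by rewrite -[RHS]sum_n1 -!big_ltn //; lia.
have d21 := dS 0%N; have d32 := dS 1%N.
(* Otherwise d 1, d 2, d 3 all equal 2, and the n-5 later positive terms push the sum to at least
   n+1. *)
have d3 : (d 3 <= 1)%N by lia.
split; last by move=> k k_gt2; apply: leq_trans d3; apply: d_mono.
move: (\sum_(4 <= i < n - 1) d i)%N E tail_ge tail_le => S E tail_ge tail_le.
have {}tail_le : (S <= (n - 1 - 4) * 1)%N.
  by apply: leq_trans tail_le _; rewrite leq_mul.
lia.
Qed.

(** Two bracketings of eyye give b = a^2, two bracketings of eyyy give b a = 0; hence a^3 = 0. *)
Lemma linear_coefs_vanish (K : fieldType) (A : vectType K)
    (mul : {bilinear A -> A -> A}) (e y : A) (a a' b b' : K) :
    associative mul -> mul e (mul e y) = 0 -> mul e (mul e (mul e e)) != 0 ->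
    mul y e = a *: mul e e + a' *: mul e y ->
    mul y y = b *: mul e e + b' *: mul e y ->
  a = 0 /\ b = 0.
Proof.
move=> mulA eey e4 ye yy.
have mDl (u v w : A) : mul (u + v) w = mul u w + mul v w by exact: linearDl.
have mDr (u v w : A) : mul w (u + v) = mul w u + mul w v by exact: linearD.
have mZl c (u v : A) : mul (c *: u) v = c *: mul u v by exact: linearZl_LR.
have mZr c (u v : A) : mul u (c *: v) = c *: mul u v by exact: linearZ.
have ze : mul (mul e y) e = a *: mul e (mul e e).
  by rewrite -mulA ye mDr !mZr eey scaler0 addr0.
have zy : mul (mul e y) y = b *: mul e (mul e e).
  by rewrite -mulA yy mDr !mZr eey scaler0 addr0.
have e3y : mul (mul e (mul e e)) y = 0 by rewrite -!mulA eey linear0r.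
have yz : mul y (mul e y) = (a' * b) *: mul e (mul e e).
  by rewrite mulA ye mDl !mZl zy -mulA eey scaler0 add0r scalerA.
have zz : mul (mul e y) (mul e y) = 0.
  by rewrite {1}mulA ze mZl e3y scaler0.
have b_def : b = a * a.
  apply/eqP; rewrite -subr_eq0; apply: contraNT e4 => ne.
  rewrite -(inj_eq (scalerI ne)) scaler0 scalerBl subr_eq0; apply/eqP.
  transitivity (mul (mul (mul e y) y) e).
    by rewrite zy mZl -!mulA.
  rewrite -[LHS]mulA ye mDr !mZr zz scaler0 addr0 [mul (mul e y) (mul e e)]mulA.
  by rewrite ze mZl scalerA -!mulA.
have ab : b * a = 0.
  apply/eqP; apply: contraNT e4 => ne.
  rewrite -(inj_eq (scalerI ne)) scaler0; apply/eqP.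
  transitivity (mul (mul (mul e y) y) y); last by rewrite zy mZl e3y scaler0.
  rewrite -[RHS]mulA yy mDr !mZr zz scaler0 addr0 [mul (mul e y) (mul e e)]mulA.
  by rewrite ze mZl scalerA -!mulA.
have a0 : a = 0 by move/eqP: ab; rewrite b_def !mulf_eq0 !orbb => /eqP.
by rewrite b_def a0 mulr0.
Qed.

Lemma naturally_graded_model_gens (K : fieldType) (A : vectType K)
    (mul : {bilinear A -> A -> A}) (n : nat) (x : A) :
    (5 < n)%N -> associative mul -> nilpotent_alg mul -> \dim {:A} = n ->
    naturally_graded mul -> x \notin apow mul 2 ->
    jordan_sizes (linfun (mul x)) [:: (n - 2)%N; 2%N] ->
  exists e y a b, model_gens n mul e y a b.
Proof.
move=> n_gt5.
have n2_gt1 : (1 < n - 2)%N by lia.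
have le_n1 : (n - 1 <= (n - 2).+1)%N by lia.
have le_n3 i : (i < n - 2)%N -> (i <= n - 3)%N by lia.
have ge_n1 i : (n - 2 <= i)%N -> (n - 1 <= i.+1)%N by lia.
have le3_n3 : (3 <= n - 3)%N by lia.
move=> mulA mul_nil dimA mul_gr x_gen.
case/jordan_two_blocks => [|nilx [v0 v0_max] rank_x]; first by lia.
have [p [N G]] := natural_grading mulA mul_nil mul_gr.
pose V k := limg (p k).
have iterx k v : iter k (linfun (mul x)) v = iter k (mul x) v.
  by apply: eq_iter => u; rewrite lfunE.
pose e := p 1%N x; pose pw k := iter k (mul e) e.
have eV : e \in V 1%N by exact: memv_proj_deg.
have [d1 V2] := deg2_sub G x_gen rank_x.
have VS := degS_sub G mulA eV V2.
have pwV k : pw k \in V k.+1.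
  by elim: k => // k IH; rewrite -[k.+2]add1n; apply: (deg_mul G).
have iter_proj k u : u \in V 1%N -> iter k (mul e) u = p k.+1 (iter k (mul x) u).
  by move=> uV; have [_ ->] := proj_iter_mul G k x u; rewrite (proj_deg G uV).
(* V_k consists of the L_e^(k-1) u with u in V_1. Such an element is the leading component of
   L_x^(k-1) u, and L_x^(n-2) = 0. *)
have V_large k : (n - 1 <= k)%N -> V k = 0%VS.
  case: k => [|k] le_k; first by lia.
  apply/eqP; rewrite -subv0; apply/subvP => v /(deg_iter VS)[u uV ->].
  rewrite iter_proj //; have -> : k = (k - (n - 2) + (n - 2))%N by lia.
  rewrite iterD -[iter (n - 2) _ u]iterx nilx.
  rewrite (_ : iter _ _ 0 = 0) ?linear0 ?mem0v //.
  by elim: (_ - _)%N => //= m ->; rewrite linear0r.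
pose u0 := p 1%N v0; have u0V : u0 \in V 1%N by exact: memv_proj_deg.
(* L_x^(n-3) v0 is nonzero and has no component below degree n-2 or above it, so its component of
   degree n-2 is nonzero. *)
have iter_u0 : iter (n - 3) (mul e) u0 != 0.
  have [low top] := proj_iter_mul G (n - 3) x v0.
  rewrite -/e -/u0 in top; rewrite -top; apply: contraNneq v0_max => top0.
  rewrite (_ : (n - 2).-1 = n - 3)%N ?iterx; last by lia.
  rewrite (grading_sum G (iter _ _ _)) big1 // => i _.
  case: (ltnP i (n - 2)) => [lt_i | ge_i]; first by rewrite low //; lia.
  case: (ltnP i (n - 1)) => [lt_i | ge_i1].
    by rewrite (_ : (i : nat) = (n - 3).+1) //; lia.
  apply/eqP; rewrite -memv0 -(V_large i ge_i1); exact: memv_proj_deg.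
have d_top : (0 < \dim (V (n - 2)))%N.
  rewrite lt0n dimv_eq0; apply: contra_neqN iter_u0 => /eqP V0.
  apply/eqP; rewrite -memv0 -V0 iter_proj // (_ : (n - 3).+1 = n - 2)%N; last by lia.
  exact: memv_proj_deg.
have [d1E d_le1] : \dim (V 1%N) = 2 /\ forall k, (2 < k)%N -> (\dim (V k) <= 1)%N.
  apply: (@dims_2211 (fun k => \dim (V k)) (N + n)%N n) => //.
  - by lia.
  - by rewrite /V (grading0 G) lim0g dimv0.
  - move=> k; apply: leq_trans (dimvS (VS k)) _.
    by rewrite -(limg_ker_dim (linfun (mul e)) (V k.+1)) leq_addl.
  - by move=> k /V_large->; rewrite dimv0.
  - by rewrite -[RHS]dimA (dim_graded G (leq_addr n N)).
have iterS_pw k u : iter k.+1 (mul e) u = mul (pw k) u.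
  by elim: k => // k IH; rewrite iterS IH mulA.
have iter_lin k c u w : iter k (mul e) (c *: u + w) = c *: iter k (mul e) u + iter k (mul e) w.
  by elim: k => //= k ->; rewrite linearP.
have line k : (2 < k.+1)%N -> pw k != 0 -> V k.+1 = <[pw k]>%VS.
  move=> k_gt2 pw_neq0; apply/eqP; rewrite eq_sym eqEdim -memvE pwV dim_vline pw_neq0.
  exact: d_le1.
have pw_le i j : (i <= j)%N -> pw j != 0 -> pw i != 0.
  move=> /subnK <-; apply: contra_neq => pwi; rewrite /pw iterD -/(pw i) pwi.
  by elim: (j - i)%N => //= m ->; rewrite linear0r.
(* [pw k] is e^(k+1). Since e^(n-3) u0 is nonzero, so are e^(n-3) and the lower power e^3. *)
have pw2 : pw 2%N != 0.
  apply: (@pw_le _ (n - 4)%N); first by lia.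
  apply: contra_neq iter_u0 => pw0.
  by rewrite (_ : n - 3 = (n - 4).+1)%N ?iterS_pw ?pw0 ?linear0l //; lia.
have e2V u : u \in V 1%N -> exists c, iter 2 (mul e) u = c *: pw 2%N.
  move=> uV; apply/vlineP; rewrite -line //.
  by rewrite iter_proj //; exact: memv_proj_deg.
(* As e^2 u0 = c e^3, the nonzero e^(n-3) u0 equals c e^(n-2). *)
have pw_top : pw (n - 3)%N != 0.
  have [c Ec] := e2V _ u0V; apply: contra_neq iter_u0 => pw0.
  have -> : (n - 3 = (n - 5) + 2)%N by lia.
  rewrite iterD Ec -[c *: _]addr0 iter_lin (_ : iter _ _ 0 = 0); last first.
    by elim: (n - 5)%N => //= m ->; rewrite linear0r.
  rewrite -iterD (_ : n - 5 + 2 = n - 3)%N -/(pw _) ?pw0 ?scaler0 ?addr0 //; lia.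
have pw_neq0 i : (i <= n - 3)%N -> pw i != 0 by move=> le_i; exact: pw_le le_i pw_top.
have pw3 : pw 3%N != 0 by exact: pw_neq0.
have e_neq0 : e != 0 := pw_le 0%N _ isT pw2.
have [u uV u_e] : exists2 u, u \in V 1%N & u \notin <[e]>%VS.
  apply/subvPn; apply/negP => /dimvS; rewrite d1E dim_vline e_neq0.
  by [].
have [c Ec] := e2V u uV.
(* Since e^2 u = c e^3, subtracting c e makes e^2 y = 0. *)
pose y := - c *: e + u.
have yV : y \in V 1%N by rewrite memvD // memvZ.
have eey : mul e (mul e y) = 0.
  by rewrite -[LHS]/(iter 2 (mul e) y) iter_lin Ec scaleNr addNr.
have y_e : y \notin <[e]>%VS.
  apply: contra u_e => y_e; have -> : u = c *: e + y by rewrite /y scaleNr addNKr.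
  by rewrite memvD // memvZ // memv_line.
have V1 : V 1%N = (<[e]> + <[y]>)%VS.
  apply/eqP; rewrite eq_sym eqEdim subv_add -!memvE eV yV d1E /= leqNgt.
  apply: contra y_e => dim_ey; rewrite memvE (subv_trans (addvSr <[e]> _)) //.
  have /eqP <- : (<[e]> == <[e]> + <[y]>)%VS; last exact: subvv.
  by rewrite eqEdim addvSl dim_vline e_neq0.
have V2E v : v \in V 2%N -> exists a b, v = a *: mul e e + b *: mul e y.
  move=> /(subvP V2)/memv_imgP[w]; rewrite -/(V 1%N) V1.
  move=> /memv_addP[_ /vlineP[a ->] [_ /vlineP[b ->] ->]] ->.
  by exists a, b; rewrite lfunE /= linearD !linearZ.
have [a [a' ye]] := V2E _ (deg_mul G yV eV : mul y e \in V 2%N).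
have [b [b' yy]] := V2E _ (deg_mul G yV yV : mul y y \in V 2%N).
have [a0 b0] := linear_coefs_vanish mulA eey pw3 ye yy.
rewrite a0 scale0r add0r in ye; rewrite b0 scale0r add0r in yy.
exists e, y, a', b'; split=> //.
  by have := pwV (n - 2)%N; rewrite V_large // memv0 => /eqP.
move=> U pwU yU eyU; apply/eqP; rewrite eqEsubv subvf; apply/subvP => v _.
rewrite (grading_sum G v); apply: memv_suml => i _.
case: i => -[|[|[|i]]] lt_i /=; first by rewrite (grading0 G) zero_lfunE mem0v.
- suff /subvP : (V 1%N <= U)%VS by apply; exact: memv_proj_deg.
  by rewrite V1 subv_add -!memvE yU andbT; apply: (pwU 0%N); exact: ltnW.
- have [s [t ->]] := V2E _ (memv_proj_deg p 2 v).
  by rewrite memvD // memvZ //; apply: (pwU 1%N).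
have [lt_in|ge_in] := ltnP i.+2 (n - 2).
  suff /subvP : (V i.+3 <= U)%VS by apply; exact: memv_proj_deg.
  by rewrite line ?pw_neq0 ?le_n3 // -memvE; apply: pwU.
have : p i.+3 v \in V i.+3 by exact: memv_proj_deg.
by rewrite V_large ?ge_n1 // memv0 => /eqP->; rewrite mem0v.
Qed.

Lemma model_gens_classification (K : fieldType) (A : vectType K)
    (mul : {bilinear A -> A -> A}) (n : nat) (e y : A) (a b : K) :
    (5 < n)%N -> associative mul -> \dim {:A} = n -> model_gens n mul e y a b ->
  [\/ exists alpha : K, alg_iso mul (mu22 n alpha),
      alg_iso mul (mu23 n)
    | alg_iso mul (mu24 n)].
Proof.
move=> n_gt5 mulA dimA gens.
have [b0 | b_neq0] := eqVneq b 0.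
  by constructor 1; exists a; rewrite mu22E -b0; exact: alg_iso_mu_model mulA gens _ _.
have [a1 | a_neq1] := eqVneq a 1.
  constructor 2; rewrite mu23E.
  (* Here a = 1 already; s = 0 keeps it and t = 1/b rescales b to 1. *)
  have gens' := @model_gens_change _ _ _ _ _ _ _ _ mulA gens 0 b^-1 1 1.
  apply: (alg_iso_mu_model mulA (gens' _ _ _ _ _)) => //.
  - by rewrite invr_neq0.
  - by rewrite mul0r addr0 oner_neq0.
  - by rewrite a1 mul0r !addr0 mulr1.
  - by rewrite mul0r addr0 mul1r mulVf.
constructor 3; rewrite mu24E.
(* The choice s = -a/b makes a + s b = 0 and 1 + s b = 1 - a, nonzero as a <> 1; then t = (1 - a)/b
   gives b' = 1. *)
have a1_neq0 : 1 - a != 0 by rewrite subr_eq0 eq_sym.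
have sb : 1 + (- a / b) * b = 1 - a by rewrite divfK.
have gens' := @model_gens_change _ _ _ _ _ _ _ _ mulA gens (- a / b) ((1 - a) / b) 0 1.
apply: (alg_iso_mu_model mulA (gens' _ _ _ _ _)) => //.
- by rewrite mulf_neq0 ?invr_neq0.
- by rewrite sb.
- by rewrite mul0r divfK // subrr.
- by rewrite sb divfK // mul1r.
Qed.

Theorem theorem4p6 (R : realType) (n : nat) (n_gt5 : (5 < n)%N) :
  (forall (A : vectType R[i]) (mul : {bilinear A -> A -> A}),
     associative mul ->
     nilpotent_alg mul ->
     \dim {:A} = n ->
     naturally_graded mul ->
     char_seq mul [:: (n - 2)%N; 2%N] ->
     [\/ exists alpha : R[i], alg_iso mul (mu22 n alpha),
         alg_iso mul (mu23 n)
       | alg_iso mul (mu24 n)])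
  /\
  [/\ forall alpha beta : R[i],
        alg_iso (mu22 n alpha) (mu22 n beta) -> alpha = beta,
      forall alpha : R[i], ~ alg_iso (mu22 n alpha) (mu23 n),
      forall alpha : R[i], ~ alg_iso (mu22 n alpha) (mu24 n)
    & ~ alg_iso (K := R[i]) (mu23 n) (mu24 n)].
Proof.
split=> [A mul mulA mul_nil dimA mul_gr [[x x_gen x_jordan] _]|].
  have [e [y [a [b gens]]]] :=
    naturally_graded_model_gens n_gt5 mulA mul_nil dimA mul_gr x_gen x_jordan.
  exact: model_gens_classification gens.
(* The parameter equations become in turn alpha x = beta x, then 0 = d twice, and finally x + y = y;
   all but the first contradict x, d <> 0. *)
rewrite mu23E mu24E; split=> [alpha beta | alpha | alpha |]; rewrite ?mu22E;
  move=> /(mu_model_iso_params n_gt5) [x [y [d [x_neq0 d_neq0]]]].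
- by rewrite !mul0r !addr0 => E _; apply: (mulIf x_neq0).
- by rewrite !mul0r !mul1r => _ /esym/eqP; rewrite (negPf d_neq0).
- by rewrite !mul0r !mul1r => _ /esym/eqP; rewrite (negPf d_neq0).
- rewrite mul0r !mul1r add0r => /eqP; rewrite -subr_eq0 addrK => /eqP x0.
  by rewrite x0 eqxx in x_neq0.
Qed.
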